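(* Let $F:\mathbb{R}^n\to\mathbb{R}^n$ be a simply switched piecewise linear function in abs-normal form, $F(x)=b+Jx+Y|c+Zx|$. If $F$ is stably coherently oriented, then $F$ is bijective.
   Context: Here $c\in\mathbb{R}^s$, $b\in\mathbb{R}^n$, $Z\in\mathbb{R}^{s\times n}$, $J\in\mathbb{R}^{n\times n}$, $Y\in\mathbb{R}^{n\times s}$, and $|\cdot|$ acts componentwise (general abs-normal form: $z=c+Zx+L|z|$, $F(x)=b+Jx+Y|z|$ with $L$ strictly lower triangular; simply switched means $L=0$). For $\sigma\in\{-1,0,1\}^s$ let $P_\sigma=\{x\in\mathbb{R}^n:\mathrm{sign}(c+Zx)=\sigma\}$ (sign componentwise); $\sigma$ is called open if $P_\sigma$ is nonempty and open. On such $P_\sigma$, $F$ is affine with Jacobian $J_\sigma=J+Y\Sigma Z$, $\Sigma=\mathrm{diag}(\sigma)$. $F$ is coherently oriented if the determinants $\det J_\sigma$, for all open $\sigma$, are nonzero and have the same sign. $F$ is stably coherently oriented if all modifications of $F$ generated by small perturbations of $[c,Z]$ are coherently oriented, i.e. there is $\varepsilon>0$ such that for all $[\tilde c,\tilde Z]\in\mathbb{R}^{s\times(1+n)}$ with $\|[\tilde c,\tilde Z]-[c,Z]\|<\varepsilon$ the function $x\mapsto b+Jx+Y|\tilde c+\tilde Zx|$ is coherently oriented. *)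

(* Defs.v *)
From mathcomp Require Import all_boot all_order all_algebra.
From mathcomp Require Import all_classical all_reals all_analysis.

Set Implicit Arguments.
Unset Strict Implicit.
Unset Printing Implicit Defensive.

Import Order.TTheory GRing.Theory Num.Theory.
Import numFieldNormedType.Exports.

Local Open Scope classical_set_scope.
Local Open Scope ring_scope.

Definition abs_normal (R : realType) (n s : nat)
    (b : 'cV[R]_n) (J : 'M[R]_n) (Y : 'M[R]_(n, s))
    (c : 'cV[R]_s) (Z : 'M[R]_(s, n)) (x : 'cV[R]_n) : 'cV[R]_n :=
  b + J *m x + Y *m map_mx (fun t : R => `|t|) (c + Z *m x).

Definition is_signature (R : realType) (s : nat) (sigma : 'cV[R]_s) : Prop :=
  forall i, sigma i 0 \in [:: -1; 0; 1].

Definition sign_cell (R : realType) (n s : nat)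
    (c : 'cV[R]_s) (Z : 'M[R]_(s, n)) (sigma : 'cV[R]_s) : set 'cV[R]_n :=
  [set x | map_mx Num.sg (c + Z *m x) = sigma].

(* An open signature may have zero entries: row i of Z can vanish together
   with c i 0. *)
Definition open_signature (R : realType) (n s : nat)
    (c : 'cV[R]_s) (Z : 'M[R]_(s, n)) (sigma : 'cV[R]_s) : Prop :=
  [/\ is_signature sigma, sign_cell c Z sigma !=set0
    & open (sign_cell c Z sigma)].

Definition jacobian_at (R : realType) (n s : nat)
    (J : 'M[R]_n) (Y : 'M[R]_(n, s)) (Z : 'M[R]_(s, n))
    (sigma : 'cV[R]_s) : 'M[R]_n :=
  J + Y *m diag_mx sigma^T *m Z.

Definition coherently_oriented (R : realType) (n s : nat)
    (J : 'M[R]_n) (Y : 'M[R]_(n, s))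
    (c : 'cV[R]_s) (Z : 'M[R]_(s, n)) : Prop :=
  (forall sigma, open_signature c Z sigma ->
     \det (jacobian_at J Y Z sigma) != 0) /\
  (forall sigma tau, open_signature c Z sigma -> open_signature c Z tau ->
     Num.sg (\det (jacobian_at J Y Z sigma)) =
     Num.sg (\det (jacobian_at J Y Z tau))).

(* The norm on [c, Z] is the entrywise maximum norm; since all norms on a
   finite-dimensional space are equivalent, the choice is immaterial. *)
Definition stably_coherently_oriented (R : realType) (n s : nat)
    (J : 'M[R]_n) (Y : 'M[R]_(n, s))
    (c : 'cV[R]_s) (Z : 'M[R]_(s, n)) : Prop :=
  exists2 eps : R, 0 < eps &
    forall (c' : 'cV[R]_s) (Z' : 'M[R]_(s, n)),
      `|row_mx c' Z' - row_mx c Z| < eps -> coherently_oriented J Y c' Z'.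

(* Main.v *)
Require Import Defs.
From mathcomp Require Import all_boot all_order all_algebra perm.
From mathcomp Require Import all_classical all_reals all_analysis.
From mathcomp Require Import ring lra.

Import Order.TTheory GRing.Theory Num.Theory.
Import numFieldNormedType.Exports.
Local Open Scope classical_set_scope.
Local Open Scope ring_scope.

Set Implicit Arguments.
Unset Strict Implicit.
Unset Printing Implicit Defensive.

(** The offset [c] is perturbed while [Z] is kept.
    For a generic offset, hyperplanes [(c + Z x) i = 0] that meet have
    independent normals (here [general_position]). Hence near any point, say
    with vanishing set [T], all sign patterns on [T] occur together with the
    fixed signs off [T], and coherent orientation bounds the Jacobian
    determinants away from zero, with one sign, at all vertices of the box of
    slopes in which the entries with index in [T] range over [-1, 1]. The
    determinant is affine in each slope ([det_jacobian_at_affine]), so the same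
    bound holds on the whole box ([det_slope_box_ge]).

    The difference of two values of the map that keeps only the absolute values
    with index in [T] is a Jacobian of the box applied to the difference of the
    arguments ([partial_abs_normal_secant]). So this map expands distances by a
    factor [m], and it is surjective ([partial_abs_normal_surj]). The perturbed
    map coincides with maps of this kind on balls of one fixed radius
    ([uniform_local_model]); contracting loops by chains of local inverses shows
    that it is globally expanding with the same factor [m] and surjective
    ([global_expansion], [lift_segment]).

    The Jacobians are built from [J], [Y], [Z] and a sign vector, and there are
    finitely many sign vectors. Hence [m] can be chosen independently of the
    perturbation. Letting the generic offsets tend to [c], the map itself is
    expanding and its range is dense; by completeness it is bijective. *)

(** * Bounds in the maximum norm *)

Lemma coord_norm_le (R : realType) (m n : nat) (A : 'M[R]_(m, n)) i j :
  `|A i j| <= `|A|.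
Proof.
by rewrite [leRHS]/Num.norm /= mx_normrE; apply/bigmax_geP; right; exists (i, j).
Qed.

Lemma mx_norm_le (R : realType) (m n : nat) (A : 'M[R]_(m, n)) (e : R) :
  0 <= e -> (forall i j, `|A i j| <= e) -> `|A| <= e.
Proof.
move=> e0 Ae; rewrite /Num.norm /= mx_normrE.
by apply/bigmax_leP; split=> // -[i j] _; apply: Ae.
Qed.

Lemma mulmx_norm_le (R : realType) (m n p : nat)
    (A : 'M[R]_(m, n)) (B : 'M[R]_(n, p)) :
  `|A *m B| <= n%:R * `|A| * `|B|.
Proof.
apply: mx_norm_le => [|i j]; first by rewrite !mulr_ge0.
rewrite mxE (le_trans (ler_norm_sum _ _ _))//.
rewrite -mulrA -[n in n%:R]card_ord mulr_natl -sumr_const ler_sum// => k _.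
by rewrite normrM ler_pM// coord_norm_le.
Qed.

Lemma det_norm_le (R : realType) (n : nat) (A : 'M[R]_n) :
  `|\det A| <= n`!%:R * `|A| ^+ n.
Proof.
rewrite /determinant (le_trans (ler_norm_sum _ _ _))//.
have -> : n`! = #|{: 'S_n}|.
  rewrite -[in LHS](card_ord n) -cardsT -card_perm; apply: eq_card => p.
  by rewrite inE unfold_in /perm_on /=; apply/fintype.subsetP => i _;
    rewrite finset.in_setT.
rewrite mulr_natl -sumr_const ler_sum// => p _.
rewrite normrM normr_sign mul1r normr_prod.
have -> : `|A| ^+ n = \prod_(i < n) `|A| by rewrite prodr_const card_ord.
by apply: ler_prod => i _; rewrite normr_ge0 coord_norm_le.
Qed.

Lemma adj_norm_le (R : realType) (n : nat) (A : 'M[R]_n) (M : R) :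
  `|A| <= M -> `|\adj A| <= n.-1`!%:R * M ^+ n.-1.
Proof.
move=> AM; have M0 : 0 <= M := le_trans (normr_ge0 _) AM.
apply: mx_norm_le => [|i j]; first by rewrite mulr_ge0 ?exprn_ge0.
rewrite mxE /cofactor normrM normrX normrN1 expr1n mul1r.
apply: (le_trans (det_norm_le _)).
rewrite ler_wpM2l// lerXn2r ?nnegrE// (le_trans _ AM)//.
by apply: mx_norm_le => // k l; rewrite !mxE coord_norm_le.
Qed.

Lemma diag_mx_norm_le1 (R : realType) (s : nat) (D : 'cV[R]_s) :
  (forall i, `|D i 0| <= 1) -> `|diag_mx D^T| <= 1.
Proof.
move=> D1; apply: mx_norm_le => // i j; rewrite !mxE.
by case: eqP => [->|_]; rewrite ?mulr1n ?mulr0n ?normr0.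
Qed.

(** By Cramer's rule a matrix can shrink a vector by at most its determinant
    divided by the size of its adjugate, and the adjugates of all these
    Jacobians lie in a bounded set. *)
Lemma jacobian_at_expanding (R : realType) (n s : nat)
    (J : 'M[R]_n) (Y : 'M[R]_(n, s)) (Z : 'M[R]_(s, n)) :
  exists2 C : R, 0 < C & forall (D : 'cV[R]_s) (v : 'cV[R]_n),
    (forall i, `|D i 0| <= 1) ->
    `|\det (jacobian_at J Y Z D)| * `|v| <=
      C * `|jacobian_at J Y Z D *m v|.
Proof.
pose M := `|J| + s%:R * (s%:R * `|Y|) * `|Z|.
have M0 : 0 <= M by rewrite addr_ge0 // !mulr_ge0.
exists (1 + n%:R * (n.-1`!%:R * M ^+ n.-1)) => [|D v D1].
  by rewrite ltr_pwDl // !mulr_ge0 ?exprn_ge0.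
set A := jacobian_at J Y Z D.
have AM : `|A| <= M.
  rewrite (le_trans (ler_normD _ _))// lerD2l.
  rewrite (le_trans (mulmx_norm_le _ _))//.
  rewrite ler_wpM2r// ler_wpM2l// (le_trans (mulmx_norm_le _ _))//.
  by rewrite ler_piMr ?mulr_ge0 // diag_mx_norm_le1.
have -> : `|\det A| * `|v| = `|\adj A *m (A *m v)|.
  by rewrite mulmxA mul_adj_mx mul_scalar_mx normrZ.
apply: (le_trans (mulmx_norm_le _ _)); rewrite ler_wpM2r//.
rewrite (@le_trans _ _ (n%:R * (n.-1`!%:R * M ^+ n.-1))) ?lerDr//.
by rewrite ler_wpM2l// adj_norm_le.
Qed.

(** * Determinants over a box of slopes *)

(** Adding to the first block column a combination of the second one clears the
    lower left block and leaves the Jacobian in the upper left one. In the block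
    matrix, unlike in the Jacobian, the entry [D i 0] occurs in one row only. *)
Lemma det_jacobian_at_block (R : realType) (n s : nat)
    (J : 'M[R]_n) (Y : 'M[R]_(n, s)) (Z : 'M[R]_(s, n)) (D : 'cV[R]_s) :
  \det (jacobian_at J Y Z D) = \det (block_mx J (- Y) (diag_mx D^T *m Z) 1%:M).
Proof.
have E : block_mx J (- Y) (diag_mx D^T *m Z) 1%:M *m
    block_mx 1%:M 0 (- (diag_mx D^T *m Z)) 1%:M =
    block_mx (jacobian_at J Y Z D) (- Y) 0 1%:M.
  rewrite mulmx_block !mulmx1 !mulmx0 !mul1mx !add0r subrr.
  by rewrite mulNmx mulmxN opprK /jacobian_at mulmxA.
move/(congr1 determinant): E.
by rewrite det_mulmx det_lblock det_ublock !det1 !mulr1 => ->.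
Qed.

Lemma det_jacobian_at_affine (R : realType) (n s : nat)
    (J : 'M[R]_n) (Y : 'M[R]_(n, s)) (Z : 'M[R]_(s, n))
    (D A B : 'cV[R]_s) (i : 'I_s) (a b : R) :
  a + b = 1 -> D i 0 = a * A i 0 + b * B i 0 ->
  (forall j, j != i -> A j 0 = D j 0) -> (forall j, j != i -> B j 0 = D j 0) ->
  \det (jacobian_at J Y Z D) =
    a * \det (jacobian_at J Y Z A) + b * \det (jacobian_at J Y Z B).
Proof.
move=> ab Di HA HB; rewrite !det_jacobian_at_block.
have other (E : 'cV[R]_s) : (forall j, j != i -> E j 0 = D j 0) ->
    row' (rshift n i) (block_mx J (- Y) (diag_mx E^T *m Z) 1%:M) =
    row' (rshift n i) (block_mx J (- Y) (diag_mx D^T *m Z) 1%:M).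
  move=> HE; apply/matrixP => k l; rewrite !mxE.
  case: splitP => // j /= kj; rewrite !mxE.
  case: splitP => // l' _; rewrite !mul_diag_mx !mxE HE//.
  apply/eqP => ji; have := neq_bump (n + i) k.
  by move: kj; rewrite /lift /= => ->; rewrite ji eqxx.
apply: (determinant_multilinear (i0 := rshift n i)); try exact: other.
apply/rowP => l; rewrite !mxE.
case: splitP => [j /= kj|j /= /eqP].
  by move: (ltn_ord j); rewrite -kj ltnNge leq_addr.
rewrite eqn_add2l => /eqP/val_inj <-.
rewrite !mxE; case: splitP => l' _; last by rewrite -mulrDl ab mul1r.
by rewrite !mul_diag_mx !mxE Di mulrDl !mulrA.
Qed.

Definition slope_box (R : realType) (s : nat) (T : {set 'I_s})
    (D : 'cV[R]_s) : set 'cV[R]_s :=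
  [set E : 'cV[R]_s | forall i,
     if i \in T then is_true (`|E i 0| <= 1) else E i 0 = D i 0].

(** The determinant is affine in each slope separately, so over a box it is at
    least the smallest of its values at the vertices. *)
Lemma det_slope_box_ge (R : realType) (n s : nat)
    (J : 'M[R]_n) (Y : 'M[R]_(n, s)) (Z : 'M[R]_(s, n))
    (T : {set 'I_s}) (D : 'cV[R]_s) (e d : R) :
  (forall E, slope_box T D E -> (forall i, i \in T -> `|E i 0| = 1) ->
     d <= e * \det (jacobian_at J Y Z E)) ->
  forall E, slope_box T D E -> d <= e * \det (jacobian_at J Y Z E).
Proof.
move=> vert.
(* Coordinates below [k] may be interior, the others are at vertices. *)
suff H k E : slope_box T D E ->
    (forall i : 'I_s, (k <= i)%N -> i \in T -> `|E i 0| = 1) ->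
    d <= e * \det (jacobian_at J Y Z E).
  by move=> E ED; apply: (H s) => // i; rewrite leqNgt ltn_ord.
elim: k E => [|k IH] E ED Evert; first by apply: vert => // i; apply: Evert.
have [ks|ks] := ltnP k s; last first.
  apply: IH => // i ki; apply: Evert; rewrite ltn_neqAle ki andbT.
  by apply/eqP => ki'; move: (ltn_ord i); rewrite -ki' ltnNge ks.
pose i := Ordinal ks.
have [iT|iT] := boolP (i \in T); last first.
  apply: IH => // j kj jT; apply: Evert => //; rewrite ltn_neqAle kj andbT.
  by apply: contraNneq iT => kj'; rewrite (_ : i = j)//; apply: val_inj.
have := ED i; rewrite iT ler_norml => /andP[E1 E2].
pose V (t : R) : 'cV[R]_s := \col_j (if j == i then t else E j 0).
have Vi t j : j != i -> V t j 0 = E j 0 by move=> /negPf ji; rewrite mxE ji.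
have VH t : `|t| = 1 -> d <= e * \det (jacobian_at J Y Z (V t)).
  move=> t1; apply: IH => [j|j kj jT].
    rewrite mxE; case: eqP => [->|_]; last exact: ED.
    by rewrite iT t1.
  rewrite mxE; case: eqP => // /eqP ji; apply: Evert => //.
  by rewrite ltn_neqAle kj andbT; apply: contraNneq ji => kj'; apply/eqP/val_inj.
pose a : R := (1 + E i 0) / 2; pose b : R := (1 - E i 0) / 2.
have a0 : 0 <= a by rewrite /a; lra.
have b0 : 0 <= b by rewrite /b; lra.
have ab : a + b = 1 by rewrite /a /b; lra.
rewrite (@det_jacobian_at_affine _ _ _ J Y Z E (V 1) (V (-1)) i a b)//; try exact: Vi.
  have := VH 1 (normr1 _); have := VH (-1) (normrN1 _).
  set x := \det _; set y := \det _ => dx dy.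
  have -> : d = a * d + b * d by rewrite -mulrDl ab mul1r.
  by rewrite mulrDr !(mulrCA e) lerD// ler_wpM2l.
by rewrite !mxE eqxx /a /b; lra.
Qed.

(** * Uniformly locally expanding maps *)

(** A short segment in the target can be lifted by hypothesis; a long one is
    lifted piece by piece, which is possible because the admissible length of a
    piece is the same at all points. *)
Lemma lift_segment (R : realType) (V W : normedModType R) (F : V -> W) (m r : R) :
  0 < m -> 0 < r ->
  (forall x y, `|y - F x| <= m * r ->
     exists2 u, F u = y & m * `|u - x| <= `|y - F x|) ->
  forall p y, exists2 q, F q = y & m * `|q - p| <= `|y - F p|.
Proof.
move=> m0 r0 lsurj p y; have mr0 : 0 < m * r by rewrite mulr_gt0.
have [N HN] : exists N : nat, `|y - F p| <= N%:R * (m * r).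
  exists (Num.bound (`|y - F p| / (m * r))).
  by rewrite -ler_pdivrMr// ltW// archi_boundP// divr_ge0// ltW.
elim: N p HN => [|N IH] p HN.
  exists p; last by rewrite subrr normr0 mulr0.
  by apply/esym/eqP; rewrite -subr_eq0 -normr_le0 -(mul0r (m * r)).
pose a : R := N.+1%:R^-1.
have a0 : 0 < a by rewrite invr_gt0 ltr0n.
have aN : a * N.+1%:R = 1 by rewrite mulVf// pnatr_eq0.
have aN' : 1 - a = a * N%:R by rewrite -{1}aN -natr1 mulrDr mulr1 addrK.
have {}HN : a * `|y - F p| <= m * r.
  by rewrite -[leRHS]mul1r -aN -mulrA ler_pM2l.
have [|u Fu mu] := lsurj p (F p + a *: (y - F p)).
  by rewrite addrAC subrr add0r normrZ gtr0_norm.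
have aN0 : 0 <= a * N%:R by rewrite mulr_ge0// ltW.
have yu : y - F u = (1 - a) *: (y - F p).
  by rewrite Fu scalerBl scale1r opprD addrA.
have [|q Fq mq] := IH u.
  rewrite yu normrZ aN' ger0_norm//.
  by rewrite mulrAC mulrC ler_wpM2l.
exists q => //.
have -> : q - p = (q - u) + (u - p) by rewrite addrA subrK.
apply: (@le_trans _ _ (m * `|q - u| + m * `|u - p|)).
  by rewrite -mulrDr ler_pM2l// ler_normD.
rewrite (le_trans (lerD mq mu))// yu [in X in _ + X]addrAC subrr add0r !normrZ.
rewrite -mulrDl aN' ger0_norm// gtr0_norm// -aN'.
by rewrite subrK mul1r.
Qed.

(** Contraction of a loop. A chain of points whose images form a loop based at
    [y] is moved by radial contraction of its image towards [y], one short step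
    at a time; the local inverses keep neighbouring points of the chain close
    and leave its two ends where they are. Once all images are [y], the chain
    must be constant. *)
Lemma chain_ends_eq (R : realType) (V W : normedModType R) (F : V -> W) (m r : R) :
  0 < m -> 0 < r ->
  (forall x u v, `|u - x| <= r -> `|v - x| <= r -> m * `|u - v| <= `|F u - F v|) ->
  (forall x y, `|y - F x| <= m * r ->
     exists2 u, F u = y & m * `|u - x| <= `|y - F x|) ->
  forall (y : W) (N k : nat) (f : nat -> V),
  F (f 0%N) = y -> F (f N) = y ->
  (forall i, (i < N)%N -> `|f i.+1 - f i| <= r / 2) ->
  (forall i, (i < N)%N -> `|F (f i.+1) - F (f i)| <= m * r / 2) ->
  (forall i, (i <= N)%N -> `|F (f i) - y| <= k%:R * (m * r / 2)) ->
  f 0%N = f N.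
Proof.
move=> m0 r0 lexp lsurj y N; elim=> [|k IH] f f0 fN near Fnear far.
  have Fy i : (i <= N)%N -> F (f i) = y.
    by move=> /far; rewrite mul0r normr_le0 subr_eq0 => /eqP.
  suff H i : (i <= N)%N -> f 0%N = f i by apply: H.
  elim: i => // i IHi iN; rewrite IHi ?(ltnW iN)//; apply/esym/eqP.
  rewrite -subr_eq0 -normr_le0 -(pmulr_rle0 _ m0).
  rewrite (le_trans (lexp (f i) _ _ _ _))//; last 2 first.
  - by rewrite subrr normr0 ltW.
  - by rewrite (Fy i.+1)// (Fy i) ?(ltnW iN)// subrr normr0.
  by rewrite (le_trans (near _ iN))//; lra.
(* The new images have distance to [y] scaled by [a], which is at most [k] short
   steps. *)
pose a : R := k%:R / k.+1%:R.
have k0 : 0 < k.+1%:R :> R by rewrite ltr0n.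
have ak : a * k.+1%:R = k%:R by rewrite mulfVK// gt_eqF.
have ak' : (1 - a) * k.+1%:R = 1 by rewrite mulrBl ak mul1r -natr1 addrAC subrr add0r.
have a0 : 0 <= a by rewrite divr_ge0.
have a1 : a <= 1 by rewrite ler_pdivrMr// mul1r ler_nat.
have move_i i : exists u, (i <= N)%N -> F u = y + a *: (F (f i) - y) /\
    m * `|u - f i| <= (1 - a) * `|F (f i) - y|.
  have [iN|_] := leqP i N; last by exists 0.
  have E : y + a *: (F (f i) - y) - F (f i) = (a - 1) *: (F (f i) - y).
    by rewrite scalerBl scale1r opprB addrA [a *: _ + y]addrC.
  have En : `|y + a *: (F (f i) - y) - F (f i)| = (1 - a) * `|F (f i) - y|.
    by rewrite E normrZ distrC ger0_norm// subr_ge0.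
  have [|u Fu mu] := lsurj (f i) (y + a *: (F (f i) - y)); last first.
    by exists u; rewrite -En.
  rewrite En (le_trans (ler_wpM2l _ (far i iN))) ?subr_ge0// (mulrA (1 - a)) ak' mul1r.
  by have := mulr_gt0 m0 r0; lra.
have [g gP] := choice move_i.
have gf i : (i <= N)%N -> `|g i - f i| <= r / 2.
  move=> iN; have [_ H] := gP i iN.
  rewrite -(ler_pM2l m0) (le_trans H)//.
  rewrite (le_trans (ler_wpM2l _ (far i iN))) ?subr_ge0//.
  by rewrite (mulrA (1 - a)) ak' mul1r mulrA.
have gend i : (i <= N)%N -> F (f i) = y -> g i = f i.
  move=> iN fy; have [_] := gP i iN; rewrite fy subrr normr0 mulr0 pmulr_rle0//.
  by rewrite normr_le0 subr_eq0 => /eqP.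
rewrite -(gend 0%N)// -(gend N)//.
have gnear i : (i < N)%N -> `|F (g i.+1) - F (g i)| <= m * r / 2.
  move=> iN; rewrite (gP i.+1 iN).1 (gP i (ltnW iN)).1.
  have -> : y + a *: (F (f i.+1) - y) - (y + a *: (F (f i) - y)) =
      a *: (F (f i.+1) - F (f i)).
    by rewrite opprD addrACA subrr add0r -scalerBr opprB addrA subrK.
  rewrite normrZ ger0_norm// (le_trans _ (Fnear i iN))//.
  by rewrite ler_piMl.
apply: IH => //.
- by rewrite gend.
- by rewrite gend.
- move=> i iN; rewrite -(ler_pM2l m0) (le_trans (lexp (f i) _ _ _ _))//.
  + have -> : g i.+1 - f i = (g i.+1 - f i.+1) + (f i.+1 - f i) by rewrite addrA subrK.
    rewrite (le_trans (ler_normD _ _))//.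
    by rewrite (le_trans (lerD (gf _ iN) (near _ iN)))//; lra.
  + by rewrite (le_trans (gf _ (ltnW iN)))//; lra.
  + by rewrite mulrA gnear.
- move=> i iN; rewrite (gP i iN).1 addrAC subrr add0r normrZ ger0_norm//.
  by rewrite (le_trans (ler_wpM2l a0 (far i iN)))// (mulrA a) ak.
Qed.

Lemma global_expansion (R : realType) (V W : normedModType R) (F : V -> W)
    (m r L : R) :
  0 < m -> 0 < r -> 0 <= L ->
  (forall u v, `|F u - F v| <= L * `|u - v|) ->
  (forall x u v, `|u - x| <= r -> `|v - x| <= r -> m * `|u - v| <= `|F u - F v|) ->
  (forall x y, `|y - F x| <= m * r ->
     exists2 u, F u = y & m * `|u - x| <= `|y - F x|) ->
  forall p q, m * `|q - p| <= `|F q - F p|.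
Proof.
move=> m0 r0 L0 lip lexp lsurj p q.
have mr0 : 0 < m * r / 2 by rewrite divr_gt0 ?mulr_gt0.
have [q' Fq' mq'] := lift_segment m0 r0 lsurj p (F q).
(* The segment from [F p] to [F q] lifts to a path from [p] to some [q'], which
   is no longer than allowed; it remains to see that it ends in [q]. *)
suff -> : q = q' by rewrite (le_trans mq')// -Fq'.
have [d {}Fq] : exists d, q' = q + d by exists (q' - q); rewrite addrC subrK.
pose N := (Num.bound (`|d| / (r / 2)) + Num.bound (L * `|d| / (m * r / 2))).+1.
have N0 : 0 < N%:R :> R by rewrite ltr0n.
have bnd (x e : R) : 0 < e -> 0 <= x -> (Num.bound (x / e) <= N)%N ->
    N%:R^-1 * x <= e.
  move=> e0 x0 H; rewrite mulrC ler_pdivrMr// -ler_pdivrMl// mulrC.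
  rewrite ltW// (lt_le_trans (archi_boundP _)) ?ler_nat//.
  by rewrite divr_ge0// ltW.
pose f (i : nat) : V := q + (i%:R / N%:R) *: d.
have f0 : f 0%N = q by rewrite /f mul0r scale0r addr0.
have fN : f N = q' by rewrite /f divff ?gt_eqF// scale1r Fq.
have fS i : `|f i.+1 - f i| = N%:R^-1 * `|d|.
  rewrite /f opprD addrACA subrr add0r -scalerBl -mulrBl -natr1 addrAC subrr add0r.
  by rewrite mul1r normrZ gtr0_norm// invr_gt0.
rewrite -f0 -fN.
apply: (@chain_ends_eq _ _ _ F m r m0 r0 lexp lsurj (F q) N
          (Num.bound (L * `|d| / (m * r / 2)))).
- by rewrite f0.
- by rewrite fN.
- move=> i _; rewrite fS; apply: bnd => //; first by rewrite divr_gt0.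
  by rewrite /N leqW// leq_addr.
- move=> i _; rewrite (le_trans (lip _ _))// fS mulrCA; apply: bnd => //.
    by rewrite mulr_ge0.
  by rewrite /N leqW// leq_addl.
- move=> i iN; rewrite (le_trans (lip _ _))// /f addrAC subrr add0r normrZ.
  rewrite ger0_norm ?divr_ge0//.
  apply: (@le_trans _ _ (L * `|d|)).
    by rewrite ler_wpM2l// ler_piMl// ler_pdivrMr// mul1r ler_nat.
  rewrite -ler_pdivrMr// ltW// archi_boundP//.
  by rewrite divr_ge0// ?mulr_ge0// ltW.
Qed.

(** * Maps with some absolute values replaced by linear functions *)

Definition partial_abs_normal (R : realType) (n s : nat)
    (b : 'cV[R]_n) (J : 'M[R]_n) (Y : 'M[R]_(n, s))
    (c : 'cV[R]_s) (Z : 'M[R]_(s, n)) (T : {set 'I_s}) (D : 'cV[R]_s)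
    (x : 'cV[R]_n) : 'cV[R]_n :=
  b + J *m x + Y *m \col_i (if i \in T then `|(c + Z *m x) i 0|
                            else D i 0 * (c + Z *m x) i 0).

(** A difference of values of a map whose nonlinear terms have difference
    quotients [e] is the Jacobian with slopes [e] applied to the difference of
    the arguments. The predicate [P] transports bounds on the quotients. *)
Lemma jacobian_at_secant (R : realType) (n s : nat)
    (b : 'cV[R]_n) (J : 'M[R]_n) (Y : 'M[R]_(n, s)) (c : 'cV[R]_s)
    (Z : 'M[R]_(s, n)) (P : 'I_s -> R -> Prop) (x x' : 'cV[R]_n) (w w' : 'cV[R]_s) :
  (forall i, exists2 e, P i e &
     w i 0 - w' i 0 = e * ((c + Z *m x) i 0 - (c + Z *m x') i 0)) ->
  exists2 E : 'cV[R]_s, (forall i, P i (E i 0)) &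
    (b + J *m x + Y *m w) - (b + J *m x' + Y *m w') =
      jacobian_at J Y Z E *m (x - x').
Proof.
move=> H; have H' i : exists e, P i e /\
    w i 0 - w' i 0 = e * ((c + Z *m x) i 0 - (c + Z *m x') i 0).
  by have [e] := H i; exists e.
have {H'} [e He] := choice H'.
exists (\col_i e i) => [i|]; first by rewrite mxE; have [] := He i.
have -> : b + J *m x + Y *m w - (b + J *m x' + Y *m w') =
    J *m (x - x') + Y *m (w - w').
  rewrite opprD addrACA opprD (addrACA b) subrr add0r.
  by rewrite !mulmxBr.
rewrite mulmxDl -!mulmxA; congr (_ + _ *m _).
apply/colP => i; rewrite mul_diag_mx mulmxBr; have [_] := He i.
by move: (Z *m x) (Z *m x') => p q; rewrite !mxE => ->; ring.
Qed.

Lemma abs_secant (R : realType) (a a' : R) :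
  exists2 e, `|e| <= 1 & `|a| - `|a'| = e * (a - a').
Proof.
have [->|aa'] := eqVneq a a'; first by exists 0; rewrite ?normr0// !subrr mulr0.
exists ((`|a| - `|a'|) / (a - a')); last by rewrite divfK// subr_eq0.
rewrite normrM normfV ler_pdivrMr ?normr_gt0 ?subr_eq0// mul1r.
exact: ler_dist_dist.
Qed.

Lemma partial_abs_normal_secant (R : realType) (n s : nat)
    (b : 'cV[R]_n) (J : 'M[R]_n) (Y : 'M[R]_(n, s)) (c : 'cV[R]_s)
    (Z : 'M[R]_(s, n)) (T : {set 'I_s}) (D : 'cV[R]_s) (x x' : 'cV[R]_n) :
  exists2 E, slope_box T D E &
    partial_abs_normal b J Y c Z T D x - partial_abs_normal b J Y c Z T D x' =
      jacobian_at J Y Z E *m (x - x').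
Proof.
apply: (@jacobian_at_secant _ _ _ _ _ _ c Z
  (fun i e => if i \in T then is_true (`|e| <= 1) else e = D i 0)) => i.
rewrite !mxE; case: (boolP (i \in T)) => iT; last by exists (D i 0); rewrite ?mulrBr.
exact: abs_secant.
Qed.

(** Induction on the number of absolute values that remain. Replacing [`|z i|]
    by [z i] and by [- z i] gives two surjective maps; let [x] and [x'] be
    points which they send to the given value. If [z i x >= 0] or [z i x' <= 0],
    that point is a solution. Otherwise [z i x < 0 < z i x'], so that the two
    substitutes [z i x] and [- z i x'] differ by less than [z i x] and [z i x']
    do; hence the difference of the two values is an invertible Jacobian of the
    box applied to [x - x']. It is zero, so [x = x'], which is absurd. *)
Lemma partial_abs_normal_surj (R : realType) (n s : nat)
    (b : 'cV[R]_n) (J : 'M[R]_n) (Y : 'M[R]_(n, s)) (c : 'cV[R]_s)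
    (Z : 'M[R]_(s, n)) (T : {set 'I_s}) (D : 'cV[R]_s) :
  (forall E, slope_box T D E -> \det (jacobian_at J Y Z E) != 0) ->
  forall y, exists x, partial_abs_normal b J Y c Z T D x = y.
Proof.
have unit_jac E : \det (jacobian_at J Y Z E) != 0 -> jacobian_at J Y Z E \in unitmx.
  by rewrite unitmxE unitfE.
elim: {T}#|T| {-2}T (erefl #|T|) D => [|k IH] T cardT D ns y.
  move/cards0_eq: cardT => T0; rewrite {T}T0 in ns *.
  have /ns/unit_jac uD : slope_box finset.set0 D D by move=> i; rewrite finset.in_set0.
  exists (invmx (jacobian_at J Y Z D) *m (y - b - Y *m (diag_mx D^T *m c))).
  set x := (X in partial_abs_normal _ _ _ _ _ _ _ X).
  have Ex : jacobian_at J Y Z D *m x = y - b - Y *m (diag_mx D^T *m c).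
    by rewrite mulKVmx.
  rewrite /partial_abs_normal (_ : \col_i _ = diag_mx D^T *m (c + Z *m x)); last first.
    by apply/colP => i; rewrite mul_diag_mx !mxE finset.in_set0.
  move: Ex; rewrite /jacobian_at mulmxDl !mulmxDr !mulmxA => Ex.
  by rewrite addrACA Ex -(addrA y) -opprD addrC subrK.
have [i iT] : exists i, i \in T by apply/finset.set0Pn; rewrite -card_gt0 cardT.
have cardTi : #|T :\ i| = k by apply/eqP; rewrite -eqSS -cardT (cardsD1 i T) iT.
pose V (t : R) : 'cV[R]_s := \col_j (if j == i then t else D j 0).
have boxV t E : `|t| <= 1 -> slope_box (T :\ i) (V t) E -> slope_box T D E.
  move=> t1 EV j; have := EV j; rewrite finset.in_setD1 mxE.
  by case: eqP => [-> /= ->|_ //]; rewrite iT.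
have sol t : `|t| <= 1 -> exists x,
    partial_abs_normal b J Y c Z (T :\ i) (V t) x = y.
  by move=> t1; apply: IH => // E /(boxV _ _ t1)/ns.
have [x Hx] := sol 1 ltac:(by rewrite normr1).
have [x' Hx'] := sol (-1) ltac:(by rewrite normrN1).
have coincide t u : `|(c + Z *m u) i 0| = t * (c + Z *m u) i 0 ->
    partial_abs_normal b J Y c Z T D u =
    partial_abs_normal b J Y c Z (T :\ i) (V t) u.
  move=> Hu; congr (_ + _ *m _); apply/colP => j.
  rewrite [LHS]mxE [RHS]mxE finset.in_setD1.
  rewrite [V t j 0]mxE; case: eqP => [->|_ //=].
  by rewrite iT Hu.
have [zx|zx] := leP 0 ((c + Z *m x) i 0).
  by exists x; rewrite (coincide 1)// mul1r ger0_norm.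
have [zx'|zx'] := leP ((c + Z *m x') i 0) 0.
  by exists x'; rewrite (coincide (-1))// mulN1r ler0_norm.
have [|E ED] := @jacobian_at_secant _ _ _ b J Y c Z
  (fun j e => if j \in T then is_true (`|e| <= 1) else e = D j 0) x x'
  (\col_j (if j \in T :\ i then `|(c + Z *m x) j 0|
          else V 1 j 0 * (c + Z *m x) j 0))
  (\col_j (if j \in T :\ i then `|(c + Z *m x') j 0|
          else V (-1) j 0 * (c + Z *m x') j 0)).
  move=> j; rewrite [X in X - _]mxE [X in _ - X]mxE finset.in_setD1.
  rewrite [V 1 j 0]mxE [V (-1) j 0]mxE.
  have [->|ji] /= := eqVneq j i.
    rewrite iT mul1r mulN1r opprK.
    set p := (X in X < 0) in zx; set q := (X in 0 < X) in zx'.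
    have pq : p - q < 0 by lra.
    exists ((p + q) / (p - q)); last by rewrite divfK// lt_eqF.
    rewrite normrM normfV ler_pdivrMr ?normr_gt0 ?lt_eqF// mul1r.
    by rewrite (ltr0_norm pq) ler_norml; apply/andP; split; lra.
  case: ifP => jT; first exact: abs_secant.
  by exists (D j 0); rewrite ?mulrBr.
move: Hx Hx'; rewrite /partial_abs_normal => -> ->; rewrite subrr => /esym E0.
have xx' : x = x'.
  apply/eqP; rewrite -subr_eq0; apply/eqP.
  by rewrite -(mulKmx (unit_jac _ (ns _ ED)) (x - x')) E0 mulmx0.
by rewrite xx' in zx; have := lt_trans zx zx'; rewrite ltxx.
Qed.

(** * Offsets in general position *)

Lemma fin_uniform (R : realType) (I : finType) (P : I -> R -> Prop) :
  (forall i e e', 0 < e' -> e' <= e -> P i e -> P i e') ->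
  (forall i, exists2 e, 0 < e & P i e) ->
  exists2 e, 0 < e & forall i, P i e.
Proof.
move=> mono H.
suff [e e0 He] : exists2 e, 0 < e & forall i, i \in enum I -> P i e.
  by exists e => // i; apply: He; rewrite mem_enum.
elim: (enum I) => [|i l [e e0 He]]; first by exists 1.
have [e' e'0 He'] := H i.
have m0 : 0 < Num.min e e' by rewrite lt_min e0.
exists (Num.min e e') => // j; rewrite in_cons => /orP[/eqP ->|jl].
  by apply: mono He' => //; rewrite ge_min lexx orbT.
by apply: mono (He j jl) => //; rewrite ge_min lexx.
Qed.

Lemma dependent_or_right_inverse (R : realType) (n s : nat) (Z : 'M[R]_(s, n))
    (T : {set 'I_s}) :
  (exists lam : 'rV[R]_s, [/\ lam != 0, forall i, i \notin T -> lam 0 i = 0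
                            & lam *m Z = 0]) \/
  (exists W : 'M[R]_(n, s), forall (tau : 'cV[R]_s) i, i \in T ->
      (Z *m (W *m tau)) i 0 = tau i 0).
Proof.
(* [P] projects to the coordinates in [T]; the rows of [K] span the relations
   between the rows of [P *m Z]. *)
pose P : 'M[R]_s := diag_mx (\row_i (i \in T)%:R).
pose K := (cokermx (P *m Z)^T)^T.
have KPZ : K *m (P *m Z) = 0.
  by apply: trmx_inj; rewrite trmx_mul trmxK mulmx_coker trmx0.
have [KP|KP] := eqVneq (K *m P) 0; [right|left].
  have /submxP[V PV] : (P^T <= (P *m Z)^T)%MS.
    by rewrite submxE -trmx_eq0 trmx_mul trmxK -/K KP.
  exists V^T => tau i iT.
  have : P *m (Z *m (V^T *m tau)) = P *m tau.
    by move/(congr1 trmx): PV; rewrite trmx_mul !trmxK => {2}->; rewrite !mulmxA.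
  by move/colP/(_ i); rewrite !mul_diag_mx [LHS]mxE [RHS]mxE mxE iT !mul1r.
have /rowV0Pn [lam /submxP[u lamE] lam0] : K *m P != 0 by [].
exists lam; split=> //.
  by move=> i iT; rewrite lamE mulmxA mul_mx_diag !mxE (negPf iT) mulr0.
by rewrite lamE -!mulmxA KPZ mulmx0.
Qed.

Lemma small_non_root (R : realType) (p : {poly R}) (e : R) :
  p != 0 -> 0 < e -> exists2 t, 0 < t < e & p.[t] != 0.
Proof.
move=> p0 e0; apply: contrapT => H.
pose rs := [seq e / (k.+2)%:R | k <- iota 0 (size p)].
suff : (size rs < size p)%N by rewrite size_map size_iota ltnn.
apply: max_poly_roots => //.
  apply/allP => _ /mapP[k _ ->]; rewrite /root; apply: contrapT => /negP pk.
  apply: H; exists (e / k.+2%:R) => //.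
  by rewrite divr_gt0//= ltr_pdivrMr// ltr_pMr// ltr1n.
rewrite map_inj_uniq ?iota_uniq// => k l /(mulfI (lt0r_neq0 e0))/invr_inj/eqP.
by rewrite eqr_nat => /eqP[].
Qed.

(** The first alternative certifies that the hyperplanes [(c + Z x) i = 0] with
    index in [T] have no common point: at such a point [lam *m (c + Z *m x)],
    which equals [lam *m c], would vanish. The second says that the rows of [Z]
    with index in [T] are independent. *)
Definition general_position (R : realType) (n s : nat) (c : 'cV[R]_s)
    (Z : 'M[R]_(s, n)) : Prop :=
  forall T : {set 'I_s},
    (exists lam : 'rV[R]_s, [/\ lam *m c != 0,
        forall i, i \notin T -> lam 0 i = 0 & lam *m Z = 0]) \/
    (exists W : 'M[R]_(n, s), forall (tau : 'cV[R]_s) i, i \in T ->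
        (Z *m (W *m tau)) i 0 = tau i 0).

(** A dependent set [T] of rows comes with a nonzero relation [lam], and
    it remains to achieve [lam *m c' != 0] for finitely many [lam]. Along the
    curve [c + (t, t ^ 2, ...)] each of these conditions says that a nonzero
    polynomial in [t] does not vanish. *)
Lemma generic_offset (R : realType) (n s : nat) (Z : 'M[R]_(s, n))
    (c : 'cV[R]_s) (e : R) :
  0 < e -> exists2 c' : 'cV[R]_s, `|c' - c| < e & general_position c' Z.
Proof.
move=> e0.
pose rinv (T : {set 'I_s}) := exists W : 'M[R]_(n, s),
  forall (tau : 'cV[R]_s) i, i \in T -> (Z *m (W *m tau)) i 0 = tau i 0.
have H (T : {set 'I_s}) : exists lam : 'rV[R]_s, rinv T \/
    [/\ lam != 0, forall i, i \notin T -> lam 0 i = 0 & lam *m Z = 0].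
  have [[lam Hlam]|HT] := dependent_or_right_inverse Z T; last by exists 0; left.
  by exists lam; right.
have [lam Hlam] := choice H.
pose p (T : {set 'I_s}) : {poly R} :=
  ((lam T *m c) 0 0)%:P + \sum_(i < s) lam T 0 i *: 'X^(i.+1).
have p0 T : lam T != 0 -> p T != 0.
  apply: contra_neq => /polyP pT; apply/rowP => i; have := pT i.+1.
  rewrite coefD coefC /= add0r coef_sum coef0 mxE (bigD1 i)//= big1 => [|j ji].
    by rewrite addr0 coefZ coefXn eqxx mulr1.
  by rewrite coefZ coefXn eqSS (inj_eq val_inj) eq_sym (negPf ji) mulr0.
have [|t /andP[t0 te] pt] := @small_non_root _ (\prod_(T | lam T != 0) p T)
    (Num.min e 1) _ ltac:(by rewrite lt_min e0 ltr01).
  by apply/prodf_neq0 => T; apply: p0.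
move: te; rewrite lt_min => /andP[te t1].
exists (c + \col_i t ^+ i.+1) => [|T].
  rewrite addrAC subrr add0r (le_lt_trans _ te)//.
  apply: mx_norm_le => [|i j]; first exact: ltW.
  rewrite mxE normrX gtr0_norm// exprS.
  by apply: ler_piMr; [exact: ltW|apply: exprn_ile1; exact: ltW].
have [?|[lam0 lamT lamZ]] := Hlam T; [by right|left].
exists (lam T); split=> //; apply: contraNneq pt => E.
rewrite horner_prod (bigD1 T)//=.
suff -> : (p T).[t] = 0 by rewrite mul0r.
move/matrixP/(_ 0 0): E; rewrite mulmxDr !mxE => E.
rewrite /p hornerD hornerC mxE -[RHS]E horner_sum; congr (_ + _).
by apply: eq_bigr => i _; rewrite hornerZ hornerXn mxE.
Qed.

(** A certificate [lam] keeps [lam *m (c + Z *m x)] at a fixed nonzero value, so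
    no point is close to all hyperplanes with index in [T]. If there is a close
    point, then the rows are independent and a right inverse gives [w]. *)
Lemma generic_right_inverse (R : realType) (n s : nat) (Z : 'M[R]_(s, n))
    (c : 'cV[R]_s) :
  general_position c Z ->
  exists2 rho : R, 0 < rho & forall (T : {set 'I_s}) (x : 'cV[R]_n),
    (forall i, i \in T -> `|(c + Z *m x) i 0| < rho) ->
    forall tau : 'cV[R]_s, exists2 w : 'cV[R]_n,
      forall i, i \in T -> (Z *m w) i 0 = tau i 0 & rho * `|w| <= `|tau|.
Proof.
move=> H; apply: fin_uniform => [T e e' e'0 ee' He x Hx tau|T].
  have [|w w1 w2] := He x _ tau; first by move=> i /Hx h; apply: lt_le_trans ee'.
  by exists w => //; rewrite (le_trans _ w2)// ler_wpM2r.
have [[lam [lamc lamT lamZ]]|[W HW]] := H T.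
  have lc0 : 0 < `|(lam *m c) 0 0|.
    rewrite normr_gt0; apply: contra_neq lamc => E.
    by apply/matrixP => i j; rewrite !ord1 E mxE.
  pose S := \sum_i `|lam 0 i|.
  have S0 : 0 <= S by apply: sumr_ge0.
  have S1 : 0 < S + 1 by rewrite ltr_wpDl.
  exists (`|(lam *m c) 0 0| / (S + 1)) => [|x Hx]; first by rewrite divr_gt0.
  have E : (lam *m c) 0 0 = (lam *m (c + Z *m x)) 0 0.
    by rewrite mulmxDr mulmxA lamZ mul0mx addr0.
  suff : `|(lam *m c) 0 0| <= S * (`|(lam *m c) 0 0| / (S + 1)).
    by rewrite mulrA ler_pdivlMr// mulrDr mulr1 mulrC gerDl leNgt lc0.
  rewrite {1}E mxE (le_trans (ler_norm_sum _ _ _))// mulr_suml ler_sum// => i _.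
  rewrite normrM; have [iT|/lamT ->] := boolP (i \in T).
    by rewrite ler_wpM2l// ltW// Hx.
  by rewrite normr0 !mul0r.
have C0 : 0 < s%:R * `|W| + 1 by rewrite ltr_wpDl ?mulr_ge0.
exists (s%:R * `|W| + 1)^-1 => [|x _ tau]; first by rewrite invr_gt0.
exists (W *m tau) => [i|]; first exact: HW.
rewrite ler_pdivrMl// (le_trans (mulmx_norm_le _ _))//.
by rewrite ler_wpM2r// lerDl.
Qed.

(** Among [s.+1] disjoint scales one contains none of [s] numbers. *)
Lemma scale_gap (R : realType) (s : nat) (z : 'I_s -> R) (rho q : R) :
  0 < rho -> 0 < q < 1 -> exists2 k, (k <= s)%N &
    forall i, z i < rho * q ^+ k.+1 \/ rho * q ^+ k <= z i.
Proof.
move=> rho0 /andP[q0 q1]; apply: contrapT => H.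
have {}H (k : 'I_s.+1) : exists i, rho * q ^+ k.+1 <= z i < rho * q ^+ k.
  apply: contrapT => Hk; apply: H; exists k; first by rewrite -ltnS.
  move=> i; have [|h1] := ltP (z i) (rho * q ^+ k.+1); first by left.
  have [|h2] := leP (rho * q ^+ k) (z i); first by right.
  by case: Hk; exists i; rewrite h1.
have [f Hf] := choice H.
have flt (k l : 'I_s.+1) : (k < l)%N -> f k <> f l.
  move=> kl fkl; have /andP[h _] := Hf k; have /andP[_] := Hf l.
  rewrite -fkl ltNge (le_trans _ h)// ler_pM2l//.
  by rewrite ler_wiXn2l// ltW.
have : (#|'I_s.+1| <= #|'I_s|)%N.
  apply: (leq_card f) => k l fkl; apply: val_inj.
  by case: (ltngtP k l) => // /flt; [move/(_ fkl)|move/(_ (esym fkl))].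
by rewrite !card_ord ltnn.
Qed.

(** * Local models of the perturbed map *)

Lemma sg_close (R : realType) (a b : R) : `|b - a| < `|a| -> Num.sg b = Num.sg a.
Proof.
rewrite ltr_distl; have [a0|a0|->] := ltrgt0P a.
- by rewrite subrr => /andP[b0 _]; rewrite !gtr0_sg.
- by rewrite opprK subrr => /andP[_ b0]; rewrite !ltr0_sg.
- by rewrite subr0 addr0 => /andP[b0 b1]; have := lt_trans b0 b1; rewrite ltxx.
Qed.

Lemma affine_coord_dist (R : realType) (n s : nat) (c : 'cV[R]_s) (Z : 'M[R]_(s, n))
    (x u : 'cV[R]_n) i :
  `|(c + Z *m u) i 0 - (c + Z *m x) i 0| <= n%:R * `|Z| * `|u - x|.
Proof.
rewrite (le_trans _ (mulmx_norm_le _ _))// (le_trans _ (coord_norm_le _ i 0))//.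
rewrite mulmxBr; move: (Z *m u) (Z *m x) => p p'; rewrite !mxE.
by rewrite opprD addrACA subrr add0r.
Qed.

Lemma open_sign_cell (R : realType) (n s : nat) (c : 'cV[R]_s) (Z : 'M[R]_(s, n))
    (sigma : 'cV[R]_s) :
  (forall i, `|sigma i 0| = 1) -> open (sign_cell c Z sigma).
Proof.
move=> sigma1; rewrite openE => x /= Hx.
have K0 : 0 < n%:R * `|Z| + 1 by rewrite ltr_wpDl ?mulr_ge0.
have [e e0 He] : exists2 e, 0 < e &
    forall i, (n%:R * `|Z| + 1) * e <= `|(c + Z *m x) i 0|.
  apply: fin_uniform => [i e e' _ ee'|i].
    by apply: le_trans; rewrite ler_wpM2l// ltW.
  have zi : 0 < `|(c + Z *m x) i 0|.
    rewrite normr_gt0 -sgr_eq0; move/colP/(_ i): Hx; rewrite mxE => ->.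
    by rewrite -normr_eq0 sigma1 oner_eq0.
  exists (`|(c + Z *m x) i 0| / (n%:R * `|Z| + 1)); first by rewrite divr_gt0.
  by rewrite mulrC divfK// gt_eqF.
apply/nbhs_ballP; exists e => //= u; rewrite -ball_normE /= distrC => xu; rewrite -Hx.
apply/colP => i; rewrite mxE [RHS]mxE; apply: sg_close.
rewrite (lt_le_trans _ (He i))// (le_lt_trans (affine_coord_dist _ _ _ _ _))//.
apply: (@le_lt_trans _ _ ((n%:R * `|Z| + 1) * `|u - x|)); last by rewrite ltr_pM2l.
by rewrite ler_wpM2r// lerDl.
Qed.

(** Near any point the map coincides with one in which only the absolute values
    of a set [T] of independent coordinates remain, and the radius does not
    depend on the point. The set [T] consists of the coordinates which are much
    smaller than all others on a suitable scale. A short step from the point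
    gives the coordinates in [T] any prescribed signs and keeps the others, so
    every vertex of the box of slopes is an open signature and coherent
    orientation controls the determinants on the whole box. *)
Lemma uniform_local_model (R : realType) (n s : nat)
    (b : 'cV[R]_n) (J : 'M[R]_n) (Y : 'M[R]_(n, s)) (c : 'cV[R]_s)
    (Z : 'M[R]_(s, n)) (d : R) :
  general_position c Z ->
  coherently_oriented J Y c Z ->
  (forall E : 'cV[R]_s, (forall i, `|E i 0| = 1) ->
     \det (jacobian_at J Y Z E) != 0 -> d <= `|\det (jacobian_at J Y Z E)|) ->
  exists2 r : R, 0 < r & forall x : 'cV[R]_n, exists T D,
    (forall u, `|u - x| <= r ->
       abs_normal b J Y c Z u = partial_abs_normal b J Y c Z T D u) /\
    (forall E, slope_box T D E ->
       (forall i, `|E i 0| <= 1) /\ d <= `|\det (jacobian_at J Y Z E)|).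
Proof.
move=> gen [ns same] dmin.
have [rho rho0 Hrho] := generic_right_inverse gen.
pose K : R := n%:R * `|Z| + 1.
have K0 : 0 < K by rewrite ltr_wpDl ?mulr_ge0.
have lipK x u i : `|(c + Z *m u) i 0 - (c + Z *m x) i 0| <= K * `|u - x|.
  by rewrite (le_trans (affine_coord_dist _ _ _ _ _))// ler_wpM2r// lerDl.
(* The ratio of two scales is such that the step below, of length at most
   [2 q ^ k.+1], moves no coordinate by [rho * q ^ k]. *)
pose q : R := rho / (rho + 2 * K).
have rK0 : 0 < rho + 2 * K by lra.
have q0 : 0 < q by rewrite divr_gt0.
have q1 : q < 1 by rewrite ltr_pdivrMr// mul1r; lra.
have Kq : K * 2 * q < rho.
  have : q * (rho + 2 * K) = rho by rewrite divfK// gt_eqF.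
  by have := mulr_gt0 q0 rho0; lra.
exists (rho * q ^+ s.+1 / K) => [|x]; first by rewrite divr_gt0// mulr_gt0// exprn_gt0.
have [k ks Hk] := @scale_gap _ s (fun i => `|(c + Z *m x) i 0|) rho q rho0
  ltac:(by rewrite q0 q1).
pose T := [set i : 'I_s | `|(c + Z *m x) i 0| < rho * q ^+ k.+1]%SET.
have inT i : i \in T -> `|(c + Z *m x) i 0| < rho * q ^+ k.+1 by rewrite inE.
have outT i : i \notin T -> rho * q ^+ k <= `|(c + Z *m x) i 0|.
  by rewrite inE => /negP; case: (Hk i).
have out0 i : i \notin T -> 0 < `|(c + Z *m x) i 0|.
  by move/outT; apply: lt_le_trans; rewrite mulr_gt0// exprn_gt0.
pose D : 'cV[R]_s := \col_i Num.sg ((c + Z *m x) i 0).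
have D1 i : i \notin T -> `|D i 0| = 1.
  by move/out0; rewrite normr_gt0 [D i 0]mxE normr_sg => ->.
have vertex E : slope_box T D E -> (forall i, i \in T -> `|E i 0| = 1) ->
    open_signature c Z E.
  move=> ED ET.
  have E1 i : `|E i 0| = 1.
    have [iT|iT] := boolP (i \in T); first exact: ET.
    by have := ED i; rewrite (negPf iT) => ->; apply: D1.
  have Esg i : Num.sg (E i 0) = E i 0.
    by rewrite [RHS]numEsg E1 mulr1.
  split; last exact: open_sign_cell.
    move=> i; rewrite -Esg !inE; case: sgrP => _; by rewrite eqxx ?orbT.
  (* The step [w] makes the coordinates in [T] equal to [rk * E i 0]. *)
  pose rk := rho * q ^+ k.+1.
  have rk0 : 0 < rk by rewrite mulr_gt0// exprn_gt0.
  pose tau : 'cV[R]_s := \col_i (if i \in T then rk * E i 0 - (c + Z *m x) i 0 else 0).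
  have tau2 : `|tau| <= 2 * rk.
    apply: mx_norm_le => [|i j]; first by rewrite mulr_ge0// ltW.
    rewrite [tau i j]mxE; case: ifPn => iT; last by rewrite normr0 mulr_ge0// ltW.
    rewrite (le_trans (ler_normB _ _))// normrM E1 mulr1 gtr0_norm//.
    by have := inT i iT; rewrite -/rk; lra.
  have [|w wT wtau] := Hrho T x _ tau.
    move=> i /inT /lt_le_trans; apply.
    by apply: ler_piMr; [exact: ltW|apply: exprn_ile1; exact: ltW].
  exists (x + w); rewrite /sign_cell/=; apply/colP => i; rewrite [LHS]mxE.
  have [iT|iT] := boolP (i \in T).
    have -> : (c + Z *m (x + w)) i 0 = rk * E i 0.
      rewrite mulmxDr addrA [LHS]mxE wT// [tau i 0]mxE iT.
      by rewrite addrC subrK.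
    by rewrite sgrM gtr0_sg// mul1r.
  have := ED i; rewrite (negPf iT) => ->; rewrite [RHS]mxE; apply: sg_close.
  rewrite (lt_le_trans _ (outT i iT))// (le_lt_trans (lipK _ _ _))//.
  rewrite addrAC subrr add0r -(ltr_pM2l rho0) mulrCA.
  apply: (@le_lt_trans _ _ (K * (2 * rk))).
    by rewrite ler_pM2l// (le_trans wtau).
  have -> : K * (2 * rk) = rho * (K * 2 * q * q ^+ k) by rewrite /rk exprS; ring.
  by rewrite ltr_pM2l// ltr_pM2r// exprn_gt0.
exists T, D; split=> [u ux|E ED].
  congr (_ + _ *m _); apply/colP => i; rewrite [LHS]mxE [RHS]mxE.
  case: ifPn => // iT; rewrite normrEsg; congr (_ * _); rewrite [RHS]mxE.
  apply: sg_close; rewrite (le_lt_trans (lipK _ _ _))//.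
  rewrite (lt_le_trans _ (outT i iT))//.
  apply: (@le_lt_trans _ _ (rho * q ^+ s.+1)).
    by rewrite -ler_pdivlMl// mulrC.
  by rewrite ltr_pM2l// ltr_iXn2l.
have Ele i : `|E i 0| <= 1.
  have := ED i; case: ifPn => // iT ->; by rewrite D1.
split=> //.
pose E0 : 'cV[R]_s := \col_i (if i \in T then 1 else D i 0).
have E0o : open_signature c Z E0.
  apply: vertex => i; first by rewrite [E0 i 0]mxE; case: (i \in T); rewrite ?normr1.
  by rewrite [E0 i 0]mxE => ->; rewrite normr1.
(* Multiplication by the common sign [e] turns the lower bounds of the absolute
   values at the vertices into lower bounds to which multiaffinity applies. *)
pose e := Num.sg (\det (jacobian_at J Y Z E0)).
have : d <= e * \det (jacobian_at J Y Z E).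
  apply: (det_slope_box_ge _ ED) => V VD VT.
  have Vo := vertex V VD VT.
  rewrite /e (same _ _ E0o Vo) -normrEsg dmin ?ns// => i.
  have [iT|iT] := boolP (i \in T); first exact: VT.
  by have := VD i; rewrite (negPf iT) => ->; apply: D1.
move/le_trans; apply; rewrite (le_trans (ler_norm _))// normrM ler_piMl//.
by rewrite /e normr_sg lern1 leq_b1.
Qed.

(** * Passage to the limit *)

Lemma abs_normal_dist (R : realType) (n s : nat)
    (b : 'cV[R]_n) (J : 'M[R]_n) (Y : 'M[R]_(n, s)) (c c' : 'cV[R]_s)
    (Z : 'M[R]_(s, n)) (u v : 'cV[R]_n) :
  `|abs_normal b J Y c Z u - abs_normal b J Y c' Z v| <=
    n%:R * `|J| * `|u - v| +
    s%:R * `|Y| * (`|c - c'| + n%:R * `|Z| * `|u - v|).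
Proof.
rewrite /abs_normal opprD addrACA opprD (addrACA b) subrr add0r -!mulmxBr.
rewrite (le_trans (ler_normD _ _))// lerD ?mulmx_norm_le//.
rewrite (le_trans (mulmx_norm_le _ _))// ler_wpM2l ?mulr_ge0//.
apply: (@le_trans _ _ `|(c + Z *m u) - (c' + Z *m v)|).
  apply: mx_norm_le => // i j; rewrite mxE mxE [X in _ + X]mxE [X in _ - X]mxE.
  rewrite (le_trans (ler_dist_dist _ _))// (le_trans _ (coord_norm_le _ i j))//.
  by rewrite [X in _ <= `|X|]mxE [X in _ <= `|_ + X|]mxE.
rewrite opprD addrACA -mulmxBr (le_trans (ler_normD _ _))// lerD2l.
exact: mulmx_norm_le.
Qed.

Lemma abs_normal_lipschitz (R : realType) (n s : nat)
    (b : 'cV[R]_n) (J : 'M[R]_n) (Y : 'M[R]_(n, s)) (c : 'cV[R]_s)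
    (Z : 'M[R]_(s, n)) :
  exists2 L : R, 0 <= L & forall u v,
    `|abs_normal b J Y c Z u - abs_normal b J Y c Z v| <= L * `|u - v|.
Proof.
exists (n%:R * `|J| + s%:R * `|Y| * (n%:R * `|Z|)) => [|u v].
  by rewrite addr_ge0 ?mulr_ge0.
rewrite (le_trans (abs_normal_dist _ _ _ _ _ _ _ _))// subrr normr0 add0r.
by rewrite mulrA -mulrDl.
Qed.

Lemma expanding_dense_surj (R : realType) (n : nat)
    (W : normedModType R) (F : 'cV[R]_n -> W) (m L : R) :
  0 < m -> 0 <= L ->
  (forall u v, `|F u - F v| <= L * `|u - v|) ->
  (forall u v, m * `|u - v| <= `|F u - F v|) ->
  (forall y e, 0 < e -> exists x, `|F x - y| <= e) ->
  forall y, exists x, F x = y.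
Proof.
move=> m0 L0 lip expd dense y.
have [x Hx] := choice (fun k : nat => dense y k.+1%:R^-1 ltac:(by rewrite invr_gt0)).
have small (e : R) : 0 < e -> \forall k \near \oo, `|F (x k) - y| <= e.
  move=> e0; exists (Num.bound e^-1) => // k /= ek.
  rewrite (le_trans (Hx k))// -[leRHS]invrK lef_pV2 ?posrE ?invr_gt0//.
  have /ltW/le_trans -> // : e^-1 < (Num.bound e^-1)%:R.
    by rewrite archi_boundP// invr_ge0 ltW.
  by rewrite ler_nat leqW.
have xcauchy : cauchy (x @ \oo).
  apply: cauchy_exP => e e0.
  have e'0 : 0 < m * e / 4 by rewrite divr_gt0// mulr_gt0.
  have [N _ HN] := small _ e'0; exists (x N).
  exists N => // k /= Nk; rewrite -ball_normE /= -(ltr_pM2l m0).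
  rewrite (le_lt_trans (expd _ _))//.
  have -> : F (x N) - F (x k) = (F (x N) - y) - (F (x k) - y).
    by rewrite opprB addrA subrK.
  rewrite (le_lt_trans (ler_normB _ _))//.
  have h1 := HN N (leqnn N); have h2 := HN k Nk; rewrite /= in h1 h2.
  by have := mulr_gt0 m0 e0; lra.
have /cvg_ex[l xl] : cvg (x @ \oo) by exact: cauchy_cvg.
exists l; apply/eqP; rewrite -subr_eq0 -normr_le0; apply/ler_addgt0Pr => e e0.
rewrite add0r.
have L1 : 0 < L + 1 by lra.
have e2 : 0 < e / 2 by lra.
have e3 : 0 < e / 2 / (L + 1) by rewrite divr_gt0.
have [N _ HN] := small _ e2.
move/cvgrPdist_le: xl => /(_ _ e3)[N' _ HN'].
have h1 : `|F (x (maxn N N')) - y| <= e / 2 by apply: HN; rewrite /= leq_maxl.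
have h2 : `|l - x (maxn N N')| <= e / 2 / (L + 1) by apply: HN'; rewrite /= leq_maxr.
set z := x _ in h1 h2.
have -> : F l - y = (F l - F z) + (F z - y) by rewrite addrA subrK.
rewrite (le_trans (ler_normD _ _))// (splitr e) lerD//.
rewrite (le_trans (lip _ _))// (le_trans (ler_wpM2l L0 h2))//.
rewrite mulrCA; apply: ler_piMr; first exact: ltW.
by rewrite ler_pdivrMr// mul1r lerDl.
Qed.

(** There are finitely many sign vectors, and the Jacobians depend on them but
    not on the offset; this is why the lower bound survives when the offset
    tends to its limit. *)
Lemma sign_vector_det_bound (R : realType) (n s : nat)
    (J : 'M[R]_n) (Y : 'M[R]_(n, s)) (Z : 'M[R]_(s, n)) :
  exists2 d : R, 0 < d & forall E : 'cV[R]_s, (forall i, `|E i 0| = 1) ->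
    \det (jacobian_at J Y Z E) != 0 -> d <= `|\det (jacobian_at J Y Z E)|.
Proof.
pose S (f : {ffun 'I_s -> bool}) : 'cV[R]_s := \col_i (-1) ^+ f i.
have [d d0 Hd] : exists2 d : R, 0 < d & forall f,
    \det (jacobian_at J Y Z (S f)) != 0 -> d <= `|\det (jacobian_at J Y Z (S f))|.
  apply: fin_uniform => [f e e' _ ee' He /He|f]; first exact: le_trans.
  have [->|ns] := eqVneq (\det (jacobian_at J Y Z (S f))) 0; first by exists 1.
  by exists `|\det (jacobian_at J Y Z (S f))|; rewrite ?normr_gt0.
exists d => // E E1.
suff -> : E = S [ffun i => E i 0 < 0] by apply: Hd.
by apply/colP => i; rewrite mxE ffunE [LHS]realEsign ?num_real// E1 mulr1.
Qed.

Unset Implicit Arguments.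

Theorem corollary4p5 (R : realType) (n s : nat)
    (b : 'cV[R]_n) (J : 'M[R]_n) (Y : 'M[R]_(n, s))
    (c : 'cV[R]_s) (Z : 'M[R]_(s, n)) :
  stably_coherently_oriented J Y c Z -> bijective (abs_normal b J Y c Z).
Proof.
move=> [eps eps0 stable].
have [d d0 Hd] := sign_vector_det_bound J Y Z.
have [C C0 HC] := jacobian_at_expanding J Y Z.
pose m := d / C; have m0 : 0 < m by rewrite divr_gt0.
have [L L0 lipF] := abs_normal_lipschitz b J Y c Z.
(* Maps with offsets close to [c], bijective and expanding with the same [m]. *)
have approx e : 0 < e -> exists G : 'cV[R]_n -> 'cV[R]_n,
    [/\ forall x, `|abs_normal b J Y c Z x - G x| <= e,
        forall p q, m * `|q - p| <= `|G q - G p| & forall y, exists x, G x = y].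
  move=> e0.
  have Y0 : 0 < s%:R * `|Y| + 1 by rewrite ltr_wpDl ?mulr_ge0.
  have del0 : 0 < Num.min eps (e / (s%:R * `|Y| + 1)) by rewrite lt_min eps0 divr_gt0.
  have [c' + gen] := generic_offset Z c del0.
  rewrite lt_min => /andP[c'eps c'e].
  have co : coherently_oriented J Y c' Z.
    apply: stable; rewrite opp_row_mx add_row_mx subrr.
    rewrite (le_lt_trans _ c'eps)//; apply: mx_norm_le => // i j.
    by rewrite mxE; case: splitP => k _; rewrite ?coord_norm_le// mxE normr0.
  have [r r0 model] := uniform_local_model b gen co Hd.
  have modelE x : exists T D, [/\ forall u, `|u - x| <= r ->
        abs_normal b J Y c' Z u = partial_abs_normal b J Y c' Z T D u,
      forall E, slope_box T D E -> \det (jacobian_at J Y Z E) != 0 &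
      forall u v, m * `|u - v| <=
        `|partial_abs_normal b J Y c' Z T D u - partial_abs_normal b J Y c' Z T D v|].
    have [T [D [eqF box]]] := model x; exists T, D.
    split; [exact: eqF|move=> E /box[_]|move=> u v].
      by rewrite -normr_gt0; apply: lt_le_trans.
    have [E /box[E1 Ed] ->] := partial_abs_normal_secant b J Y c' Z T D u v.
    rewrite /m mulrAC ler_pdivrMr// mulrC [leRHS]mulrC (le_trans _ (HC _ _ E1))//.
    by rewrite mulrC ler_wpM2r.
  have lexp x u v : `|u - x| <= r -> `|v - x| <= r ->
      m * `|u - v| <= `|abs_normal b J Y c' Z u - abs_normal b J Y c' Z v|.
    by have [T [D [eqF _ H]]] := modelE x => ux vx; rewrite !eqF.
  have lsurj x y : `|y - abs_normal b J Y c' Z x| <= m * r ->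
      exists2 u, abs_normal b J Y c' Z u = y &
        m * `|u - x| <= `|y - abs_normal b J Y c' Z x|.
    have [T [D [eqF ns H]]] := modelE x => yx.
    have [u Hu] := partial_abs_normal_surj b c' ns y.
    have mu : m * `|u - x| <= `|y - abs_normal b J Y c' Z x|.
      by rewrite -Hu (eqF x) ?H// subrr normr0 ltW.
    exists u => //; rewrite eqF// -(ler_pM2l m0).
    exact: le_trans yx.
  have [L' L'0 lipG] := abs_normal_lipschitz b J Y c' Z.
  exists (abs_normal b J Y c' Z); split.
  - move=> x; rewrite (le_trans (abs_normal_dist _ _ _ _ _ _ _ _))//.
    rewrite subrr normr0 !mulr0 add0r addr0 distrC.
    move: c'e; rewrite ltr_pdivlMr// => /ltW; apply: le_trans.
    by rewrite mulrC ler_wpM2l// lerDl.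
  - exact: global_expansion m0 r0 L'0 lipG lexp lsurj.
  - by move=> y; have [q] := lift_segment m0 r0 lsurj 0 y; exists q.
have expF u v : m * `|u - v| <= `|abs_normal b J Y c Z u - abs_normal b J Y c Z v|.
  apply/ler_addgt0Pr => e e0.
  have [G [FG expG _]] := approx (e / 2) ltac:(by rewrite divr_gt0).
  rewrite (le_trans (expG v u))//.
  have -> : G u - G v = (abs_normal b J Y c Z u - abs_normal b J Y c Z v) -
     (abs_normal b J Y c Z u - G u) + (abs_normal b J Y c Z v - G v).
    move: (G u) (G v) (abs_normal _ _ _ _ _ u) (abs_normal _ _ _ _ _ v) => *.
    by apply/colP => i; rewrite !mxE; ring.
  apply: (le_trans (ler_normD _ _)); rewrite [e in leRHS]splitr addrA.
  apply: lerD; last exact: FG.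
  by apply: (le_trans (ler_normB _ _)); rewrite lerD2l; exact: FG.
have surjF : forall y, exists x, abs_normal b J Y c Z x = y.
  apply: (expanding_dense_surj m0 L0 lipF expF) => y e e0.
  have [G [FG _ surjG]] := approx e e0.
  by have [x Gx] := surjG y; exists x; rewrite -Gx.
have [g Fg] := choice surjF.
exists g => [x|y]; last exact: Fg.
apply/eqP; rewrite -subr_eq0 -normr_le0 -(pmulr_rle0 _ m0).
by rewrite (le_trans (expF _ _))// Fg subrr normr0.
Qed.
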